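(* Let $M,W,D$ be sets with $|M|=|W|=|D|=n$ and let complete preference matrices $r_{MW},r_{MD},r_{WM},r_{WD},r_{DM},r_{DW}$ be given. Then there exists a (strong) stable matching, i.e. a three-dimensional matching $\mu$ for which there is no weakly blocking triple, and such a matching can be found in quadratic time $O(n^2)$.
   Context: Every agent of each of the three genders $M$ (men), $W$ (women), $D$ (dogs) has a strict complete preference list over the agents of each of the two other genders: for distinct $X,Y\in\{M,W,D\}$ and $x\in X$, the map $y\mapsto r_{XY}(x,y)$ is a bijection $Y\to\{1,\dots,n\}$, and $r_{XY}(x,y)$ is the rank that $x$ assigns to $y$ (rank 1 is the best). A three-dimensional matching $\mu$ is a set of $n$ pairwise disjoint triples $(m,w,d)\in M\times W\times D$ (so every agent is in exactly one triple). If $x\in X$ lies in a triple of $\mu$ whose element of gender $Y\ne X$ is $y$, put $R_{\mu,Y}(x)=r_{XY}(x,y)$. A triple $(m,w,d)\in M\times W\times D$ with $(m,w,d)\notin\mu$ is weakly blocking for $\mu$ if all six of the following inequalities hold: $r_{MW}(m,w)\le R_{\mu,W}(m)$, $r_{WM}(w,m)\le R_{\mu,M}(w)$, $r_{DM}(d,m)\le R_{\mu,M}(d)$, $r_{MD}(m,d)\le R_{\mu,D}(m)$, $r_{WD}(w,d)\le R_{\mu,D}(w)$, $r_{DW}(d,w)\le R_{\mu,W}(d)$. (The elements $m,w,d$ need not belong to three distinct triples of $\mu$.) Running time is counted in elementary operations, the input being the six $n\times n$ matrices. *)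

(* Defs.v *)
From mathcomp Require Import all_boot.

Set Implicit Arguments.
Unset Strict Implicit.
Unset Printing Implicit Defensive.

Record prefs (M W D : finType) := Prefs {
  rMW : M -> W -> nat;
  rMD : M -> D -> nat;
  rWM : W -> M -> nat;
  rWD : W -> D -> nat;
  rDM : D -> M -> nat;
  rDW : D -> W -> nat
}.

(* For each [x], the map [r x] is a bijection onto {1, ..., n}. *)
Definition complete_ranking (n : nat) (X Y : finType) (r : X -> Y -> nat) :=
  forall x : X,
    [/\ forall y, 1 <= r x y <= n,
        injective (r x)
      & forall k, 1 <= k <= n -> exists y, r x y = k].

Definition complete_prefs (n : nat) (M W D : finType) (r : prefs M W D) :=
  [/\ complete_ranking n (rMW r) /\ complete_ranking n (rMD r),
      complete_ranking n (rWM r) /\ complete_ranking n (rWD r)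
    & complete_ranking n (rDM r) /\ complete_ranking n (rDW r)].

Section Matchings.
Variables M W D : finType.
Implicit Types (r : prefs M W D) (mu : {set M * W * D}) (t : M * W * D).

Definition man_of t : M := t.1.1.
Definition woman_of t : W := t.1.2.
Definition dog_of t : D := t.2.

(* The genders are distinct types, so disjointness of two triples means that
   they differ in each component. *)
Definition disjoint_triples t u :=
  [/\ man_of t <> man_of u, woman_of t <> woman_of u & dog_of t <> dog_of u].

Definition matching (n : nat) mu :=
  #|mu| = n /\
  (forall t u, t \in mu -> u \in mu -> t <> u -> disjoint_triples t u).

(* [R_(mu,Y)(x)], where [fX] and [fY] extract the components of genders X and
   Y of a triple. The value 0 is only taken when [x] is in no triple of [mu],
   which cannot happen when [mu] is a matching of #|X| triples. *)
Definition partner_rank (X Y : finType) (r : X -> Y -> nat)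
    (fX : M * W * D -> X) (fY : M * W * D -> Y) mu (x : X) : nat :=
  if [pick t in mu | fX t == x] is Some t then r x (fY t) else 0.

Definition weakly_blocking r mu (m : M) (w : W) (d : D) :=
  (m, w, d) \notin mu /\
  [/\ rMW r m w <= partner_rank (rMW r) man_of woman_of mu m,
      rWM r w m <= partner_rank (rWM r) woman_of man_of mu w
    & rDM r d m <= partner_rank (rDM r) dog_of man_of mu d] /\
  [/\ rMD r m d <= partner_rank (rMD r) man_of dog_of mu m,
      rWD r w d <= partner_rank (rWD r) woman_of dog_of mu w
    & rDW r d w <= partner_rank (rDW r) dog_of woman_of mu d].

Definition strongly_stable r mu := forall m w d, ~ weakly_blocking r mu m w d.

End Matchings.

(* Model of computation: a unit-cost random access machine on natural numbers.
   It has registers and two-dimensional arrays, both indexed by constants of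
   the program. An elementary operation is the loading of a constant, a copy,
   an addition, a truncated subtraction, a read or write of one array entry
   whose two indices are held in registers, or a comparison of two registers.
   Multiplication is left out, as is usual when every operation has unit
   cost whatever the size of its operands. *)
Definition reg := nat.
Definition arr := nat.

Record state := State {
  regs : reg -> nat;
  arrs : arr -> nat -> nat -> nat
}.

Inductive op :=
  | Const (x : reg) (k : nat)
  | Copy (x y : reg)
  | Add (x y z : reg)
  | Sub (x y z : reg)
  | Read (x : reg) (a : arr) (i j : reg)
  | Write (a : arr) (i j : reg) (x : reg).

Inductive test :=
  | Lt (x y : reg)
  | Eq (x y : reg).

Inductive cmd :=
  | Skip
  | Op (o : op)
  | Seq (c1 c2 : cmd)
  | If (b : test) (c1 c2 : cmd)
  | While (b : test) (c : cmd).

Definition set_reg (s : state) (x : reg) (v : nat) : state :=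
  State (fun y => if y == x then v else regs s y) (arrs s).

Definition set_arr (s : state) (a : arr) (i j v : nat) : state :=
  State (regs s)
    (fun a' i' j' =>
       if [&& a' == a, i' == i & j' == j] then v else arrs s a' i' j').

Definition run_op (o : op) (s : state) : state :=
  match o with
  | Const x k => set_reg s x k
  | Copy x y => set_reg s x (regs s y)
  | Add x y z => set_reg s x (regs s y + regs s z)
  | Sub x y z => set_reg s x (regs s y - regs s z)
  | Read x a i j => set_reg s x (arrs s a (regs s i) (regs s j))
  | Write a i j x => set_arr s a (regs s i) (regs s j) (regs s x)
  end.

Definition run_test (b : test) (s : state) : bool :=
  match b with
  | Lt x y => regs s x < regs s y
  | Eq x y => regs s x == regs s y
  end.

(* [exec c s t s']: started in [s], the command [c] halts in [s'] after
   exactly [t] elementary operations. *)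
Inductive exec : cmd -> state -> nat -> state -> Prop :=
  | ExecSkip s : exec Skip s 1 s
  | ExecOp o s : exec (Op o) s 1 (run_op o s)
  | ExecSeq c1 c2 s s1 s2 t1 t2 :
      exec c1 s t1 s1 -> exec c2 s1 t2 s2 -> exec (Seq c1 c2) s (t1 + t2) s2
  | ExecIfTrue b c1 c2 s s1 t :
      run_test b s = true -> exec c1 s t s1 -> exec (If b c1 c2) s t.+1 s1
  | ExecIfFalse b c1 c2 s s1 t :
      run_test b s = false -> exec c2 s t s1 -> exec (If b c1 c2) s t.+1 s1
  | ExecWhileFalse b c s :
      run_test b s = false -> exec (While b c) s 1 s
  | ExecWhileTrue b c s s1 s2 t1 t2 :
      run_test b s = true -> exec c s t1 s1 -> exec (While b c) s1 t2 s2 ->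
      exec (While b c) s (t1 + t2).+1 s2.

(* Determinism: the existence of an execution is the same as termination of
   the run, and its result and running time are those of the run. *)
Lemma exec_det c s t1 s1 t2 s2 :
  exec c s t1 s1 -> exec c s t2 s2 -> t1 = t2 /\ s1 = s2.
Proof.
move=> e1; elim: e1 t2 s2 => {c s t1 s1} *;
  match goal with H : exec _ _ ?t ?s |- _ = ?t /\ _ = ?s =>
    inversion H; subst end => //; try congruence;
  repeat match goal with
    IH : (forall t s, exec ?c ?s0 t s -> _ = t /\ _ = s),
    H : exec ?c ?s0 ?t ?s |- _ =>
      have [? ?] := IH t s H; clear IH; subst end; by [].
Qed.

(* The matrix of [r]: its rows and columns are numbered from 0 following the
   enumerations of [X] and [Y]; entries outside the matrix are 0. *)
Definition pref_matrix (X Y : finType) (r : X -> Y -> nat) (i j : nat) : nat :=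
  match (insub i : option 'I_#|X|), (insub j : option 'I_#|Y|) with
  | Some i', Some j' => r (enum_val i') (enum_val j')
  | _, _ => 0
  end.

(* Initially register 0 holds [n], arrays 0 to 5 hold the six matrices, and
   everything else is 0. *)
Definition input_state (n : nat) (M W D : finType) (r : prefs M W D) : state :=
  State
    (fun x => if x == 0 then n else 0)
    (fun a => match a with
              | 0 => pref_matrix (rMW r)
              | 1 => pref_matrix (rMD r)
              | 2 => pref_matrix (rWM r)
              | 3 => pref_matrix (rWD r)
              | 4 => pref_matrix (rDM r)
              | 5 => pref_matrix (rDW r)
              | _ => fun _ _ => 0
              end).

(* The output is the list of [n] triples in rows 0 to n-1 of array 6, whose
   columns 0, 1 and 2 hold the numbers of the man, the woman and the dog. *)
Definition output_triples (n : nat) (M W D : finType) (s : state) :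
    {set M * W * D} :=
  [set t : M * W * D | [exists k : 'I_n,
    [&& arrs s 6 k 0 == enum_rank (man_of t) :> nat,
        arrs s 6 k 1 == enum_rank (woman_of t) :> nat
      & arrs s 6 k 2 == enum_rank (dog_of t) :> nat]]].

Definition bigO (f g : nat -> nat) :=
  exists C n0 : nat, forall n, n0 <= n -> f n <= C * g n.

(* Main.v *)
Require Import Defs.
From mathcomp Require Import all_boot.
From mathcomp Require Import zify.

(** The three genders decouple. Take a stable marriage [F : M -> W] between men
and women, a stable marriage [G : M -> D] between men and dogs, and join them
along the men into the triples [(m, F m, G m)]. If [(m, w, d)] were weakly
blocking, the inequalities between [m] and [w] alone would say that neither
prefers the assigned partner strictly to the other; as rankings have no ties,
stability of [F] forces [w = F m]. The inequalities between [m] and [d] force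
[d = G m] in the same way, so the triple belongs to the matching after all
(lemma [join_stable]).

Quadratic time comes from running the Gale-Shapley algorithm twice, with the men
proposing. Each run consists of two unnested loops with bodies of constant cost.
The loop of [invert_step] inverts the preference matrix of the men, so that the
agent of a given rank is found by one array access; each iteration treats one
matrix entry. The loop of [propose_step] makes one proposal per iteration, and a
man never proposes twice to the same agent, so it has at most [n * n]
iterations. The invariant [deferred] of the second loop is stated for functions
on numbers, independently of the machine; it is maintained by [rejected] and
[accepted], and [not_exhausted] shows that a free man always has somebody left
to propose to. [proposing_end] reads stability off the invariant, and [runs_while] turns the decreasing measures into time bounds. Existence of a
stable matching is a by-product of the correctness of the program. *)

Set Implicit Arguments.
Unset Strict Implicit.
Unset Printing Implicit Defensive.

(** * Time bounds for programs *)

Fixpoint loop_free (c : cmd) : bool :=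
  match c with
  | Skip | Op _ => true
  | Seq c1 c2 | If _ c1 c2 => loop_free c1 && loop_free c2
  | While _ _ => false
  end.

(** Meaningful for loop-free commands only, like [cost]: the values on loops are
arbitrary. For a concrete loop-free command, [sem] computes the final state
symbolically. *)
Fixpoint sem (c : cmd) (s : state) : state :=
  match c with
  | Skip | While _ _ => s
  | Op o => run_op o s
  | Seq c1 c2 => sem c2 (sem c1 s)
  | If b c1 c2 => if run_test b s then sem c1 s else sem c2 s
  end.

Fixpoint cost (c : cmd) : nat :=
  match c with
  | Skip | Op _ | While _ _ => 1
  | Seq c1 c2 => cost c1 + cost c2
  | If _ c1 c2 => (maxn (cost c1) (cost c2)).+1
  end.

Definition runs (c : cmd) (s : state) (t : nat) (Q : state -> Prop) :=
  exists t' s', [/\ exec c s t' s', t' <= t & Q s'].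

Lemma runs_loop_free c s (Q : state -> Prop) :
  loop_free c -> Q (sem c s) -> runs c s (cost c) Q.
Proof.
move=> lf Qs; suff [t e le_t]: exists2 t, exec c s t (sem c s) & t <= cost c.
  by exists t, (sem c s).
elim: c s lf {Q Qs} => //= [|o|c1 IH1 c2 IH2|b c1 IH1 c2 IH2] s.
- by exists 1 => //; constructor.
- by exists 1 => //; constructor.
- case/andP=> /(IH1 s)[t1 e1 l1] /(IH2 (sem c1 s))[t2 e2 l2].
  by exists (t1 + t2); [exact: ExecSeq e1 e2 | lia].
- case/andP=> /(IH1 s)[t1 e1 l1] /(IH2 s)[t2 e2 l2]; case: ifP => bs.
    by exists t1.+1; [exact: ExecIfTrue | lia].
  by exists t2.+1; [exact: ExecIfFalse | lia].
Qed.

Lemma runs_seq c1 c2 s t1 t2 (Q1 Q2 : state -> Prop) :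
  runs c1 s t1 Q1 -> (forall s1, Q1 s1 -> runs c2 s1 t2 Q2) ->
  runs (Seq c1 c2) s (t1 + t2) Q2.
Proof.
move=> [u1 [s1 [e1 l1 /[swap]]]] /[apply] -[u2 [s2 [e2 l2 Q2s]]].
by exists (u1 + u2), s2; split=> //; [exact: ExecSeq e1 e2 | lia].
Qed.

(** Since [c] is loop-free, every iteration costs at most [cost c], plus one for
the test; a measure that decreases at each iteration bounds their number. *)
Lemma runs_while b c (I : state -> Prop) (mu : state -> nat) s :
    loop_free c ->
    (forall s', I s' -> run_test b s' ->
       I (sem c s') /\ mu (sem c s') < mu s') ->
    I s ->
  runs (While b c) s ((cost c).+1 * mu s).+1
    (fun s' => I s' /\ run_test b s' = false).
Proof.
move=> lf step; have [k] := ubnP (mu s); elim: k s => // k IH s mu_k Is.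
case: (boolP (run_test b s)) => bs; last first.
  exists 1, s; split=> //; first by constructor; exact: negbTE.
  by split=> //; exact: negbTE.
have [Is' mu_s'] := step s Is bs.
have [|t2 [s2 [e2 l2 Q2]]] := IH (sem c s) _ Is'; first by lia.
have [t1 [s1 [e1 l1 Es1]]] :=
  @runs_loop_free c s (fun s1 => s1 = sem c s) lf erefl.
rewrite {}Es1 in e1; exists (t1 + t2).+1, s2; split=> //.
  exact: ExecWhileTrue e1 e2.
have: (cost c).+1 * (mu (sem c s)).+1 <= (cost c).+1 * mu s.
  by rewrite leq_mul2l mu_s' orbT.
by rewrite mulnS; lia.
Qed.

(** * Deferred acceptance *)

Definition complete_matrix (n : nat) (A : nat -> nat -> nat) :=
  forall i, i < n ->
    [/\ forall j, j < n -> 1 <= A i j <= n,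
        forall j j', j < n -> j' < n -> A i j = A i j' -> j = j'
      & forall k, 1 <= k <= n -> exists2 j, j < n & A i j = k].

Section DeferredAcceptance.
Variables (n : nat) (A B : nat -> nat -> nat).
Hypothesis A_complete : complete_matrix n A.

(** The men enter one after the other. The men up to [i] have entered, and [cur]
is the only one of them without a partner; at the end [i] and [cur] both equal
[n], so that every man has a partner. [nx m] is the rank of the last agent to
whom [m] has proposed, and [hs w] is the number of the partner of [w] plus one,
or 0 if [w] is free. [wife] is the partner of a man and [man] the identity, but
only the values at men who have a partner are meaningful: other entries may be
stale.

[answered] carries stability: every [w] to whom [m] has proposed holds a partner
whom [w] likes at least as much as [m]. *)
Record deferred (i cur : nat) (nx hs man wife : nat -> nat) : Prop := Deferred {
  cur_le : cur <= i <= n;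
  cur_end : i = n -> cur = n;
  answered : forall m w, m < n -> w < n -> A m w <= nx m ->
    exists2 h, hs w = h.+1 & B w h <= B w m;
  engaged : forall w h, w < n -> hs w = h.+1 ->
    [/\ h < n /\ h <= i, h <> cur, A h w = nx h, man h = h & wife h = w];
  placed : forall m, m <= i -> m <> cur -> exists2 w, w < n & hs w = m.+1
}.

Lemma deferred0 nx hs man wife :
  (forall m, nx m = 0) -> (forall w, hs w = 0) -> deferred 0 0 nx hs man wife.
Proof.
move=> nx0 hs0; split=> //.
- move=> m w mn wn; rewrite nx0.
  by have [/(_ w wn)] := A_complete mn; lia.
- by move=> w h _; rewrite hs0.
- by lia.
Qed.

(** If [cur] had been through the whole list, all [n] agents would have
partners. Sending each agent to its partner would be an injective, hence
surjective, map between sets of [n] elements, yet it misses [cur]. *)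
Lemma not_exhausted i cur nx hs man wife :
  deferred i cur nx hs man wife -> i < n -> nx cur < n.
Proof.
move=> [cur_i _ ans eng _] i_n; rewrite ltnNge; apply/negP=> n_nx.
have cur_n : cur < n by lia.
have /fin_all_exists[g gE] (w : 'I_n) : exists h : 'I_n, hs w = h.+1.
  have [h hw _] : exists2 h, hs w = h.+1 & B w h <= B w cur.
    apply: ans => //; have [/(_ w (ltn_ord w))] := A_complete cur_n; lia.
  have [[h_n _] _ _ _ _] := eng _ _ (ltn_ord w) hw.
  by exists (Ordinal h_n).
have g_inj : injective g.
  move=> w w' gww'; apply: val_inj => /=.
  have [_ _ _ _ <-] := eng _ _ (ltn_ord w) (gE w).
  by have [_ _ _ _ <-] := eng _ _ (ltn_ord w') (gE w'); rewrite gww'.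
have /codomP[w gw] := inj_card_onto g_inj (leqnn _) (Ordinal cur_n).
have [_ + _ _ _] := eng _ _ (ltn_ord w) (gE w).
by rewrite -gw.
Qed.

(** One proposal, of [cur] to the next agent [w] on his list. *)
Section Step.
Variables (i cur w : nat) (nx hs man wife nx' : nat -> nat).
Hypotheses (inv : deferred i cur nx hs man wife) (i_n : i < n).
Hypotheses (w_n : w < n) (Aw : A cur w = (nx cur).+1).
Hypothesis nx'E : forall m, nx' m = if m == cur then (nx cur).+1 else nx m.

Lemma rejected h hs' man' wife' :
    hs w = h.+1 -> B w h <= B w cur ->
    hs' =1 hs -> man' =1 man -> wife' =1 wife ->
  deferred i cur nx' hs' man' wife'.
Proof.
case: inv => cur_i ends ans eng plc hw le_B hsE manE wifeE.
have cur_n : cur < n by lia.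
split=> //.
- move=> m v mn vn; rewrite nx'E hsE; case: eqP => [->|_] Amv; last exact: ans.
  have [lt_A|eq_A] : A cur v <= nx cur \/ A cur v = (nx cur).+1 by lia.
    exact: ans.
  have [_ A_inj _] := A_complete cur_n.
  by have -> : v = w; [apply: A_inj => //; lia | exists h].
- move=> v k vn; rewrite hsE manE wifeE nx'E => hv.
  have [kn kc Ak mk wk] := eng v k vn hv.
  by split=> //; case: eqP.
- by move=> m mi mc; have [v vn hv] := plc m mi mc; exists v; rewrite ?hsE.
Qed.

(** Acceptance by a free agent lets the next man enter; acceptance by an agent
with partner [h] frees [h], who becomes the proposer. *)
Lemma accepted i' cur' hs' man' wife' :
    (if hs w is h.+1 then [/\ B w cur <= B w h, i' = i & cur' = h]
     else i' = i.+1 /\ cur' = i.+1) ->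
    (forall v, hs' v = if v == w then cur.+1 else hs v) ->
    (forall m, man' m = if m == cur then cur else man m) ->
    (forall m, wife' m = if m == cur then w else wife m) ->
  deferred i' cur' nx' hs' man' wife'.
Proof.
case: inv => cur_i ends ans eng plc next hsE manE wifeE.
have cur_n : cur < n by lia.
(* Distinct agents have distinct partners, as [wife] recovers the agent. *)
have old v k : v < n -> v <> w -> hs v = k.+1 -> hs w <> k.+1.
  move=> vn vw hv hw; apply: vw.
  have [_ _ _ _ <-] := eng v k vn hv.
  by have [_ _ _ _ <-] := eng w k w_n hw.
have cur'_P : [/\ i <= i' <= n, cur' <= i', i' = n -> cur' = n & cur' <> cur].
  case hw: (hs w) next => [|h]; first by case=> -> ->; split; lia.
  case=> _ -> ->.
  by have [h_n h_cur _ _ _] := eng w h w_n hw; split; lia.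
have cur'_free k v : v < n -> v <> w -> hs v = k.+1 -> k <> cur'.
  move=> vn vw hv; have := old v k vn vw hv; have [+ _ _ _ _] := eng v k vn hv.
  by case hw: (hs w) next => [|h] []; lia.
case: cur'_P => i'_i cur'_i' cur'_end cur'_new; split.
- by lia.
- by [].
- (* A partner is only replaced by one liked at least as much. *)
  have up v m : v < n -> (exists2 h, hs v = h.+1 & B v h <= B v m) ->
    exists2 h, hs' v = h.+1 & B v h <= B v m.
    move=> vn [h hv le_B]; rewrite hsE; case: eqP => [vw|_]; last by exists h.
    by exists cur => //; move: next; rewrite -vw hv => -[? _ _]; lia.
  move=> m v mn vn; rewrite nx'E; case: eqP => [->|_] Amv; last first.
    by apply: up => //; exact: ans.
  have [lt_A|eq_A] : A cur v <= nx cur \/ A cur v = (nx cur).+1 by lia.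
    by apply: up => //; exact: ans.
  have [_ A_inj _] := A_complete cur_n.
  have -> : v = w by apply: A_inj => //; lia.
  by exists cur; rewrite ?hsE ?eqxx.
- move=> v k vn; rewrite hsE manE wifeE nx'E; case: eqP => [->|vw] hv.
    have <- : cur = k by lia.
    by rewrite eqxx; split=> //; lia.
  have [kn kc Ak mk wk] := eng v k vn hv.
  case: eqP => [//|_]; split=> //; first by lia.
  exact: cur'_free hv.
- move=> m mi mc; have [->|m_cur] := eqVneq m cur.
    by exists w; rewrite ?hsE ?eqxx.
  have m_i : m <= i by case: (hs w) next => [|h] [? ?]; lia.
  have [v vn hv] := plc m m_i (elimN eqP m_cur); exists v => //.
  rewrite hsE; case: eqP => // vw.
  by move: next; rewrite -vw hv => -[_ _ ?]; lia.
Qed.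

End Step.

End DeferredAcceptance.

(** * The program *)

(** Registers: 0 holds [n], 1 the constant one, 2 the column [c] of the present
run, 3 the constant zero; 4 and 5 are the loop variables, and 6 to 11 are
temporary. Arrays: 6 is the output, 7 the inverted preference matrix, which both
runs overwrite, 8 and 9 the functions [nx] and [hs] of [deferred]. Each run uses
its own column [c] of the arrays 6, 8 and 9: the second run thus starts from
zeros in 8 and 9 and leaves the result of the first one intact. Column 0 of the
output is written by both runs, with the same values.

The double loop over matrix entries is flattened: the column index, in register
5, wraps around at [n] and then increments the row index. *)
Definition invert_step (a : arr) : cmd :=
  Seq (Op (Read 6 a 4 5))
 (Seq (Op (Write 7 4 6 5))
 (Seq (Op (Add 5 5 1))
      (If (Eq 5 0) (Seq (Op (Const 5 0)) (Op (Add 4 4 1))) Skip))).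

(** Makes [cur] and the agent in register 7 partners. *)
Definition engage : cmd :=
  Seq (Op (Write 9 7 2 11)) (Seq (Op (Write 6 5 2 7)) (Op (Write 6 5 3 5))).

(** Registers 4 and 5 hold the variables [i] and [cur] of [deferred]. *)
Definition propose_step (b : arr) : cmd :=
  Seq (Op (Read 6 8 5 2))
 (Seq (Op (Add 6 6 1))
 (Seq (Op (Write 8 5 2 6))
 (Seq (Op (Read 7 7 5 6))
 (Seq (Op (Read 8 9 7 2))
 (Seq (Op (Add 11 5 1))
      (If (Eq 8 3)
         (Seq engage (Seq (Op (Add 4 4 1)) (Op (Copy 5 4))))
         (Seq (Op (Defs.Sub 8 8 1))
         (Seq (Op (Read 9 b 7 8))
         (Seq (Op (Read 10 b 7 5))
              (If (Lt 10 9) (Seq engage (Op (Copy 5 8))) Skip)))))))))).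

Definition start (c : nat) : cmd :=
  Seq (Op (Const 1 1))
 (Seq (Op (Const 2 c)) (Seq (Op (Const 4 0)) (Op (Const 5 0)))).

Definition restart : cmd := Seq (Op (Const 4 0)) (Op (Const 5 0)).

Definition gale_shapley (a b : arr) (c : nat) : cmd :=
  Seq (start c)
 (Seq (While (Lt 4 0) (invert_step a))
 (Seq restart (While (Lt 4 0) (propose_step b)))).

(** * Correctness of the program *)

Definition writable (c : nat) (x : arr) (j : nat) : bool :=
  (x == 7) || (x \in [:: 6; 8; 9]) && ((j == c) || (j == 0)).

Record frame (n c : nat) (s0 s : state) : Prop := Frame {
  reg_n : regs s 0 = n;
  reg_1 : regs s 1 = 1;
  reg_c : regs s 2 = c;
  reg_0 : regs s 3 = 0;
  unwritten : forall x i j, ~~ writable c x j -> arrs s x i j = arrs s0 x i j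
}.

Lemma frame_reg n c s0 s x v :
  3 < x -> frame n c s0 s -> frame n c s0 (set_reg s x v).
Proof. by case: x => [|[|[|[|x]]]] // _ []; split. Qed.

Lemma frame_arr n c s0 s x i j v :
  writable c x j -> frame n c s0 s -> frame n c s0 (set_arr s x i j v).
Proof.
move=> wr [r0 r1 r2 r3 unw]; split=> //= x' i' j' nwr.
case: and3P => [[/eqP xx' _ /eqP jj']|_]; last exact: unw.
by move: nwr; rewrite xx' jj' wr.
Qed.

Section Pass.
Variables (n c : nat) (a b : arr) (A B : nat -> nat -> nat) (s0 : state).
Hypotheses (a_input : a < 6) (b_input : b < 6) (c_gt0 : 0 < c).
Hypothesis aE : forall i j, arrs s0 a i j = A i j.
Hypothesis bE : forall i j, arrs s0 b i j = B i j.
Hypothesis A_complete : complete_matrix n A.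

(** Invariant of the first loop: the entries that precede the current one in
row-major order have been treated. *)
Record inverting (s : state) : Prop := Inverting {
  inv_frame : frame n c s0 s;
  inv_bound : regs s 4 <= n;
  inv_col : regs s 4 < n -> regs s 5 < n;
  inv_done : forall i j, i < n -> j < n ->
    i < regs s 4 \/ i = regs s 4 /\ j < regs s 5 -> arrs s 7 i (A i j) = j;
  inv_fresh : forall (x : arr) i j, x != 7 -> arrs s x i j = arrs s0 x i j
}.

Lemma inverting_step s :
    inverting s -> run_test (Lt 4 0) s ->
  inverting (sem (invert_step a) s) /\
  n * n - (regs (sem (invert_step a) s) 4 * n + regs (sem (invert_step a) s) 5)
    < n * n - (regs s 4 * n + regs s 5).
Proof.
case=> fr bnd col don fresh; have [r0 r1 r2 r3 _] := fr.
rewrite /sem /run_test /run_op /= r0 r1 addn1 => i_n.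
have {col} j_n := col i_n.
rewrite fresh; last by lia.
rewrite aE.
set i := regs s 4 in bnd don i_n j_n *; set j := regs s 5 in don j_n *.
have [_ A_inj _] := A_complete i_n.
have don' i' j' : i' < n -> j' < n -> i' < i \/ i' = i /\ j' <= j ->
    (if (i' == i) && (A i' j' == A i j) then j else arrs s 7 i' (A i' j')) = j'.
  move=> i'n j'n; case: eqP => [->|i'i] /=; last by move=> ?; apply: don; lia.
  case: eqP => [/A_inj ->//|Ajj'] ?; apply: don => //.
  suff: j' <> j by lia.
  by move=> j'j; apply: Ajj'; rewrite j'j.
have fresh' (x : arr) i' j' : x != 7 ->
    (if [&& x == 7, i' == i & j' == A i j] then j else arrs s x i' j')
    = arrs s0 x i' j'.
  by move=> x7; rewrite (negbTE x7) fresh.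
case: eqP => [jn|jn]; split=> /=; try split=> //=.
- by do 3!(apply: frame_reg => //); apply: frame_arr => //; exact: frame_reg.
- by lia.
- by lia.
- by move=> i' j' i'n j'n ?; apply: don' => //; lia.
- by nia.
- by apply: frame_reg => //; apply: frame_arr => //; exact: frame_reg.
- by rewrite -/i; lia.
- by rewrite -/i; nia.
Qed.

Record proposing (s : state) : Prop := Proposing {
  prop_frame : frame n c s0 s;
  prop_list : forall i j, i < n -> j < n -> arrs s 7 i (A i j) = j;
  prop_deferred : deferred n A B (regs s 4) (regs s 5)
    (fun m => arrs s 8 m c) (fun w => arrs s 9 w c)
    (fun m => arrs s 6 m 0) (fun m => arrs s 6 m c)
}.

Definition proposals_left (s : state) := \sum_(m < n) (n - arrs s 8 m c).

Lemma proposals_left_lt s s' cur :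
    cur < n -> arrs s 8 cur c < n ->
    (forall m, arrs s' 8 m c =
               if m == cur then (arrs s 8 cur c).+1 else arrs s 8 m c) ->
  proposals_left s' < proposals_left s.
Proof.
move=> cur_n nx_n s'E; rewrite /proposals_left.
rewrite (bigD1 (Ordinal cur_n)) //= [ltnRHS](bigD1 (Ordinal cur_n)) //=.
have -> : \sum_(m < n | m != Ordinal cur_n) (n - arrs s' 8 m c)
        = \sum_(m < n | m != Ordinal cur_n) (n - arrs s 8 m c).
  by apply: eq_bigr => m; rewrite s'E -val_eqE /= => /negbTE->.
by rewrite s'E eqxx ltn_add2r; lia.
Qed.

Lemma proposing_step s :
    proposing s -> run_test (Lt 4 0) s ->
  proposing (sem (propose_step b) s) /\
  proposals_left (sem (propose_step b) s) < proposals_left s.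
Proof.
case=> fr lst dfr; have [r0 r1 r2 r3 unw] := fr.
rewrite /sem /run_test /run_op /= r0 r1 r2 r3 => i_n.
have nx_n := not_exhausted A_complete dfr i_n.
have cur_n : regs s 5 < n by case: dfr => cur_i _ _ _ _; lia.
have [_ _ A_surj] := A_complete cur_n.
have /A_surj[w w_n Aw] : 1 <= (arrs s 8 (regs s 5) c).+1 <= n by lia.
have bE' v h : arrs s b v h = B v h.
  rewrite -bE; apply: unw; rewrite /writable !inE.
  by move: b_input; rewrite /arr; lia.
have b8 : (b == 8) = false by move: b_input; rewrite /arr; lia.
have c0 : (c == 0) = false by lia.
have wr x : x \in [:: 6; 7; 8; 9] -> writable c x c.
  by rewrite /writable !inE eqxx andbT; case/or4P=> ->; rewrite ?orbT.
rewrite addn1 -Aw lst //= b8 !bE' /= !addn1 subn1.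
set cur := regs s 5 in dfr cur_n Aw nx_n *; set i := regs s 4 in dfr i_n *.
(* The contents of the updated arrays, in the form in which they arise by
   symbolic execution. *)
have nx'E m : (if (m == cur) && (c == c) then A cur w else arrs s 8 m c)
    = (if m == cur then (arrs s 8 cur c).+1 else arrs s 8 m c).
  by rewrite eqxx andbT Aw.
have hs'E v : (if (v == w) && (c == c) then cur.+1 else arrs s 9 v c)
    = (if v == w then cur.+1 else arrs s 9 v c).
  by rewrite eqxx andbT.
have man'E m : (if (m == cur) && true then cur else
    if (m == cur) && (0 == c) then w else arrs s 6 m 0)
    = (if m == cur then cur else arrs s 6 m 0).
  by case: eqP.
have wife'E m : (if (m == cur) && (c == 0) then cur else
    if (m == cur) && (c == c) then w else arrs s 6 m c)
    = (if m == cur then w else arrs s 6 m c).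
  by rewrite c0 eqxx; case: eqP.
have fr' v : frame n c s0
    (set_arr (set_reg (set_reg s 6 v) 6 (A cur w)) 8 cur c (A cur w)).
  by apply: frame_arr; [exact: wr | do 2!(apply: frame_reg => //)].
have fr'' s1 v : frame n c s0 s1 ->
    frame n c s0 (set_arr (set_arr (set_arr s1 9 w c v) 6 cur c w) 6 cur 0 cur).
  move=> ?; apply: frame_arr; first by rewrite /writable orbT.
  by do 2!(apply: frame_arr; first exact: wr).
case hw: (arrs s 9 w c) => [|h] /=; last case: ltnP => le_B.
- split; last by apply: (proposals_left_lt cur_n nx_n) => m; exact: nx'E.
  split=> //=.
    do 2!(apply: frame_reg => //); apply: fr''.
    by do 3!(apply: frame_reg => //).
  apply: (accepted A_complete dfr i_n w_n Aw nx'E _ hs'E man'E wife'E).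
  by rewrite hw.
- split; last by apply: (proposals_left_lt cur_n nx_n) => m; exact: nx'E.
  split=> //=.
    by apply: frame_reg => //; apply: fr''; do 6!(apply: frame_reg => //).
  apply: (accepted A_complete dfr i_n w_n Aw nx'E _ hs'E man'E wife'E).
  by rewrite hw; split=> //; exact: ltnW.
- split; last by apply: (proposals_left_lt cur_n nx_n) => m; exact: nx'E.
  split=> //=; first by do 6!(apply: frame_reg => //).
  exact: (rejected A_complete dfr i_n w_n Aw nx'E hw le_B).
Qed.

(** Column [c] of the output is a stable marriage: if a man likes [w] at least
as much as his own partner, then [w] has a partner and likes this partner at
least as much as that man. *)
Record stable_column (s : state) : Prop := StableColumn {
  col_man : forall m, m < n -> arrs s 6 m 0 = m;
  col_lt : forall m, m < n -> arrs s 6 m c < n;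
  col_inj : forall m m', m < n -> m' < n ->
    arrs s 6 m c = arrs s 6 m' c -> m = m';
  col_stable : forall m w, m < n -> w < n -> A m w <= A m (arrs s 6 m c) ->
    exists h, [/\ h < n, arrs s 6 h c = w & B w h <= B w m]
}.

Lemma proposing_end s :
  proposing s -> run_test (Lt 4 0) s = false -> stable_column s.
Proof.
case=> -[r0 _ _ _ _] _ [cur_i ends ans eng plc]; rewrite /= r0 => i_n.
have iE : regs s 4 = n by lia.
have {}plc m : m < n -> exists w,
    [/\ w < n, arrs s 9 w c = m.+1, A m w = arrs s 8 m c,
      arrs s 6 m 0 = m & arrs s 6 m c = w].
  move=> m_n; have [||w w_n hw] := plc m; try by have := ends iE; lia.
  by have [_ _ ? ? ?] := eng w m w_n hw; exists w.
split.
- by move=> m /plc[w [_ _ _ -> _]].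
- by move=> m /plc[w [? _ _ _ ->]].
- move=> m m' /plc[w [_ hw _ _ ->]] /plc[w' [_ hw' _ _ ->]] ww'.
  by move: hw; rewrite ww' hw' => -[].
- move=> m w m_n w_n; have [v [_ _ Av _ ->]] := plc m m_n.
  rewrite Av => /(ans m w m_n w_n)[h hw le_B]; exists h.
  by have [[? _] _ _ _ ?] := eng w h w_n hw.
Qed.

Definition pass_time : nat :=
  cost (start c) + (((cost (invert_step a)).+1 * (n * n)).+1
    + (cost restart + ((cost (propose_step b)).+1 * (n * n)).+1)).

Lemma gale_shapley_runs :
    regs s0 0 = n -> regs s0 3 = 0 ->
    (forall i, arrs s0 8 i c = 0) -> (forall i, arrs s0 9 i c = 0) ->
  runs (gale_shapley a b c) s0 pass_time
    (fun s => frame n c s0 s /\ stable_column s).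
Proof.
move=> r0 r3 nx0 hs0.
apply: (@runs_seq _ _ _ _ _
    (fun s => inverting s /\ n * n - (regs s 4 * n + regs s 5) = n * n)).
  apply: runs_loop_free => //=; split; last by rewrite subn0.
  by split=> //=; lia.
move=> s1 [inv1 mu1]; rewrite -[X in _.+1 * X]mu1.
apply: runs_seq.
  exact: (@runs_while (Lt 4 0) (invert_step a) inverting
    (fun s => n * n - (regs s 4 * n + regs s 5)) s1 erefl inverting_step inv1).
move=> {inv1 mu1} s2 [[fr bnd _ don fresh] /= i_n].
have [f0 f1 f2 f3 unw] := fr.
apply: (@runs_seq _ _ _ _ _ (fun s => proposing s /\ proposals_left s = n * n)).
  apply: runs_loop_free => //=; split; last first.
    rewrite /proposals_left; under eq_bigr do rewrite /= fresh // nx0 subn0.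
    by rewrite sum_nat_const card_ord.
  split=> /=; first by do 2!(apply: frame_reg => //).
    by move=> i j i_lt j_lt; apply: don => //; lia.
  by apply: deferred0 => // m; rewrite fresh.
move=> s3 [inv3 mu3]; rewrite -[X in _.+1 * X]mu3.
have [t' [s' [e le_t [inv' test']]]] :=
  @runs_while (Lt 4 0) (propose_step b) proposing proposals_left s3
    erefl proposing_step inv3.
exists t', s'; split=> //; split; first by case: inv'.
exact: proposing_end.
Qed.

End Pass.

(** * From numbers back to agents *)

Lemma pref_matrix_rank (X Y : finType) (r : X -> Y -> nat) x y :
  pref_matrix r (enum_rank x) (enum_rank y) = r x y.
Proof. by rewrite /pref_matrix !valK !enum_rankK. Qed.

Lemma rank_surj n (X : finType) i :
  #|X| = n -> i < n -> exists x : X, i = enum_rank x.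
Proof.
by move=> <- i_lt; exists (enum_val (Ordinal i_lt)); rewrite enum_valK.
Qed.

Lemma complete_pref_matrix n (X Y : finType) (r : X -> Y -> nat) :
  #|X| = n -> #|Y| = n -> complete_ranking n r ->
  complete_matrix n (pref_matrix r).
Proof.
move=> cX cY cr i /(rank_surj cX)[x ->].
have [rng inj surj] := cr x; split.
- by move=> j /(rank_surj cY)[y ->]; rewrite pref_matrix_rank.
- move=> j j' /(rank_surj cY)[y ->] /(rank_surj cY)[y' ->].
  by rewrite !pref_matrix_rank => /inj->.
- move=> k /surj[y yk].
  by exists (enum_rank y); rewrite ?pref_matrix_rank // -cY.
Qed.

Lemma stable_pairing n c (X Y : finType) (r : X -> Y -> nat)
    (r' : Y -> X -> nat) (s : state) :
    #|X| = n -> #|Y| = n ->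
    stable_column n c (pref_matrix r) (pref_matrix r') s ->
  exists F : X -> Y,
    [/\ forall x, arrs s 6 (enum_rank x) c = enum_rank (F x), injective F
      & forall x y, r x y <= r x (F x) ->
          exists x', F x' = y /\ r' y x' <= r' y x].
Proof.
move=> cX cY [_ lt inj st].
have rkX (x : X) : enum_rank x < n by rewrite -cX.
have rkY (y : Y) : enum_rank y < n by rewrite -cY.
have /fin_all_exists[F FE] (x : X) :
    exists y : Y, arrs s 6 (enum_rank x) c = enum_rank y.
  by apply: (rank_surj cY); exact: lt.
exists F; split=> //.
- move=> x x' Fxx'; apply: enum_rank_inj; apply: val_inj.
  by apply: inj => //=; rewrite !FE Fxx'.
- move=> x y le_r.
  have [|h [h_n hy le_r']] := st (enum_rank x) (enum_rank y) (rkX x) (rkY y).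
    by rewrite FE !pref_matrix_rank.
  move: h_n hy le_r' => /(rank_surj cX)[x' ->].
  rewrite FE !pref_matrix_rank => /val_inj/enum_rank_inj Fx' le_r'.
  by exists x'.
Qed.

Lemma partner_rankE (M W D X Y : finType) (r : X -> Y -> nat)
    (fX : M * W * D -> X) (fY : M * W * D -> Y) (mu : {set M * W * D}) t :
  {in mu &, injective fX} -> t \in mu ->
  partner_rank r fX fY mu (fX t) = r (fX t) (fY t).
Proof.
move=> inj t_mu; rewrite /partner_rank; case: pickP => [u /andP[u_mu /eqP]|].
  by move=> /inj->.
by move/(_ t); rewrite t_mu eqxx.
Qed.

(** * Joining two stable marriages *)

Section Join.
Variables (n : nat) (M W D : finType) (r : prefs M W D).
Variables (F : M -> W) (G : M -> D).
Hypotheses (cM : #|M| = n) (F_inj : injective F) (G_inj : injective G).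
Hypothesis r_complete : complete_prefs n r.

Definition join : {set M * W * D} := [set (m, F m, G m) | m : M].

Lemma join_man : {in join &, injective (@man_of M W D)}.
Proof.
by move=> _ _ /imsetP[m _ ->] /imsetP[m' _ ->]; rewrite /man_of /= => ->.
Qed.

Lemma join_woman : {in join &, injective (@woman_of M W D)}.
Proof. by move=> _ _ /imsetP[m _ ->] /imsetP[m' _ ->] /F_inj->. Qed.

Lemma join_dog : {in join &, injective (@dog_of M W D)}.
Proof. by move=> _ _ /imsetP[m _ ->] /imsetP[m' _ ->] /G_inj->. Qed.

Lemma join_matching : matching n join.
Proof.
split; first by rewrite card_imset // => m m' [].
move=> t u tj uj tu; split=> e; apply: tu.
- exact: join_man e.
- exact: join_woman e.
- exact: join_dog e.
Qed.

Hypothesis F_stable : forall m w, rMW r m w <= rMW r m (F m) ->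
  exists m', F m' = w /\ rWM r w m' <= rWM r w m.
Hypothesis G_stable : forall m d, rMD r m d <= rMD r m (G m) ->
  exists m', G m' = d /\ rDM r d m' <= rDM r d m.

(** A weakly blocking triple satisfies the hypotheses of both stability
conditions. These give reversed inequalities for the ranks by [w] and by [d], so
that [m] has the same rank as the partner, hence is the partner. *)
Lemma join_stable : strongly_stable r join.
Proof.
have inj m : (m, F m, G m) \in join by apply/imsetP; exists m.
have [_ [cWM _] [cDM _]] := r_complete.
move=> m w d [/negP nj [[mw wm dm] [md _ _]]]; apply: nj.
move: mw md.
rewrite (partner_rankE _ _ join_man (inj m)) => /F_stable[m1 [m1w le1]].
rewrite (partner_rankE _ _ join_man (inj m)) => /G_stable[m2 [m2d le2]].
move: wm dm; rewrite -{2}m1w -{2}m2d.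
rewrite (partner_rankE _ _ join_woman (inj m1)) /=.
rewrite (partner_rankE _ _ join_dog (inj m2)) /=.
rewrite m1w m2d => le1' le2'.
have [_ injw _] := cWM w; have [_ injd _] := cDM d.
have m1m : m1 = m by apply: injw; apply/eqP; rewrite eqn_leq le1 le1'.
have m2m : m2 = m by apply: injd; apply/eqP; rewrite eqn_leq le2 le2'.
by rewrite -m1w -m2d m1m m2m.
Qed.

End Join.

(** * Two runs of the Gale-Shapley program *)

(** Arrays 0 and 2 hold the preferences between men and women, 1 and 4 those
between men and dogs. *)
Definition solver : cmd := Seq (gale_shapley 0 2 1) (gale_shapley 1 4 2).

Lemma solver_correct n (M W D : finType) (r : prefs M W D) :
    #|M| = n -> #|W| = n -> #|D| = n -> complete_prefs n r ->
  runs solver (input_state n r) (pass_time n 1 0 2 + pass_time n 2 1 4)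
    (fun s => matching n (output_triples n M W D s) /\
              strongly_stable r (output_triples n M W D s)).
Proof.
move=> cM cW cD cr; have [[cMW cMD] _ _] := cr.
have cptMW := complete_pref_matrix cM cW cMW.
have cptMD := complete_pref_matrix cM cD cMD.
apply: runs_seq.
  exact: (@gale_shapley_runs n 1 0 2 _ _ (input_state n r) _ _ _ _ _ cptMW).
move=> s1 [[r0 _ _ r3 unw] st1].
have [t [s [e le_t [fr st2]]]] :
  runs (gale_shapley 1 4 2) s1 (pass_time n 2 1 4)
    (fun s => frame n 2 s1 s /\
      stable_column n 2 (pref_matrix (rMD r)) (pref_matrix (rDM r)) s).
  by apply: (@gale_shapley_runs n 2 1 4) => //; move=> *; rewrite unw.
exists t, s; split=> //.
(* The second run does not write column 1 of the output. *)
have st1' : stable_column n 1 (pref_matrix (rMW r)) (pref_matrix (rWM r)) s.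
  case: fr => _ _ _ _ unw2; case: st1 => _ lt inj st; case: st2 => man _ _ _.
  split=> //.
  - by move=> m m_n; rewrite unw2 //; exact: lt.
  - by move=> m m' m_n m'_n; rewrite !unw2 //; exact: inj.
  - move=> m w m_n w_n; rewrite unw2 // => /(st m w m_n w_n)[h [h_n hw le_h]].
    by exists h; rewrite unw2.
have [F [FE F_inj F_st]] := stable_pairing cM cW st1'.
have [G [GE G_inj G_st]] := stable_pairing cM cD st2.
suff -> : output_triples n M W D s = join F G.
  by split; [exact: join_matching | exact: join_stable cr _ _].
have manE (m : M) : arrs s 6 (enum_rank m) 0 = enum_rank m.
  by case: st2 => man _ _ _; apply: man; rewrite -cM.
apply/setP=> -[[m w] d]; rewrite inE /man_of /woman_of /dog_of /=.
apply/existsP/imsetP => [[k /and3P[]]|[m' _ [-> -> ->]]]; last first.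
  by exists (cast_ord cM (enum_rank m')); rewrite /= manE FE GE !eqxx.
have [m' m'E] : exists m' : M, (k : nat) = enum_rank m'.
  exact: (rank_surj cM).
rewrite m'E manE FE GE => /eqP/val_inj/enum_rank_inj <-.
move=> /eqP/val_inj/enum_rank_inj <- /eqP/val_inj/enum_rank_inj <-.
by exists m'.
Qed.

Theorem mainTheorem3 :
  (forall (n : nat) (M W D : finType) (r : prefs M W D),
     #|M| = n -> #|W| = n -> #|D| = n -> complete_prefs n r ->
     exists mu : {set M * W * D}, matching n mu /\ strongly_stable r mu)
  /\
  (exists (P : cmd) (T : nat -> nat),
     bigO T (fun n => n ^ 2) /\
     forall (n : nat) (M W D : finType) (r : prefs M W D),
       #|M| = n -> #|W| = n -> #|D| = n -> complete_prefs n r ->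
       exists (t : nat) (s : state),
         [/\ exec P (input_state n r) t s,
             t <= T n,
             matching n (output_triples n M W D s)
           & strongly_stable r (output_triples n M W D s)]).
Proof.
split.
  move=> n M W D r cM cW cD cr.
  have [_ [s [_ _ [mu_m mu_s]]]] := solver_correct cM cW cD cr.
  by exists (output_triples n M W D s).
exists solver, (fun n => pass_time n 1 0 2 + pass_time n 2 1 4); split.
  (* The bound is [u * n ^ 2 + v] with constants [u] and [v], hence at most
     [u + v] times [n ^ 2] when [n >= 1]. *)
  exists (pass_time 1 1 0 2 + pass_time 1 2 1 4), 1 => n n_gt0.
  by rewrite expnS expn1 /pass_time /=; nia.
move=> n M W D r cM cW cD cr.
have [t [s [e le_t [mu_m mu_s]]]] := solver_correct cM cW cD cr.
by exists t, s.
Qed.
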